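(* Let $(X,d)$ be a complete metric space, let $\psi,\phi:(0,\infty)\to\mathbb{R}$ be functions, and let $T:X\times X\to X$ be a map such that for all $z=(x,y)$, $w=(u,v)$ in $X\times X$ with $\max\{d(T(x,y),T(u,v)),\,d(T(y,x),T(v,u))\}>0$, $$\psi\big(d(Tz,Tw)\big)\le \phi\big(\max\{d(x,u),d(y,v)\}\big).$$ Suppose that: (i) $\psi$ is nondecreasing; (ii) $\phi(t)<\psi(t)$ for every $t>0$; (iii) $\limsup_{t\to\epsilon+}\phi(t)<\psi(\epsilon+)$ for every $\epsilon>0$. Then there exists a unique point $\xi^*=(x^*,y^* )\in X\times X$ such that $x^*=T(x^*,y^* )$ and $y^*=T(y^*,x^* )$, and the iterative sequences $x_n=T^n(x,y)$ and $y_n=T^n(y,x)$ converge to $x^*$ and $y^*$ respectively, for any $(x,y)\in X\times X$.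
   Context: $\psi(\epsilon+)$ denotes the right-hand limit $\lim_{t\to\epsilon+}\psi(t)$. For $T:X\times X\to X$ the iterates are defined by $T^1=T$ and $T^n(x,y)=T\big(T^{n-1}(x,y),T^{n-1}(y,x)\big)$ for $n\ge 2$. For $z=(x,y)$, $Tz$ means $T(x,y)$. *)

(* Defs.v *)
From HB Require Import structures.
From mathcomp Require Import all_boot all_order all_algebra.
From mathcomp Require Import all_classical all_reals all_analysis.

Set Implicit Arguments.
Unset Strict Implicit.
Unset Printing Implicit Defensive.

(* [Complete] already includes a point, so these spaces are nonempty. *)
#[short(type="completeMetricType")]
HB.structure Definition CompleteMetric (K : numDomainType) :=
  { M of Complete M & Metric K M }.

(* T^n (x, y) = T (T^(n-1) (x, y), T^(n-1) (y, x)), started one step early at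
   the first projection, so that T^1 = T holds by computation. *)
Fixpoint coupled_iter (X : Type) (T : X * X -> X) (n : nat) (x y : X) : X :=
  if n is m.+1 then T (coupled_iter T m x y, coupled_iter T m y x) else x.

(* Main.v *)
(* Equip X * X with the maximum metric, which makes it complete, and put
   F (x, y) = (T (x, y), T (y, x)). The contraction inequality passes to F,
   because one of the two coordinates attains the maximum and the right-hand
   side is symmetric. As psi is nondecreasing and phi < psi, F strictly decreases
   distances. By (iii), phi t < psi (e+) <= psi s for s > e and for t > e close
   to e, so points at distance less than e + d have images at distance at most e.
   For such a map the distance between two orbits tends to 0. Hence, for
   large n, u_n and u_(n+1) are at distance less than d, and then
   dist (u_n, u_(n+k+1)) <= dist (u_n, u_(n+1)) + dist (F u_n, F u_(n+k)) < e + d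
   by induction on k, so orbits are Cauchy. *)
Require Import Defs.
From HB Require Import structures.
From mathcomp Require Import all_boot all_order all_algebra.
From mathcomp Require Import all_classical all_reals all_analysis.
Import Order.TTheory GRing.Theory Num.Theory numFieldNormedType.Exports.
Local Open Scope classical_set_scope.
Local Open Scope ring_scope.

Definition prod_mdist {R : realFieldType} {X Y : metricType R}
  (z w : X * Y) : R := Num.max (mdist z.1 w.1) (mdist z.2 w.2).

Lemma prod_mdist_ge0 (R : realFieldType) (X Y : metricType R) (z w : X * Y) :
  0 <= prod_mdist z w.
Proof. by rewrite le_max mdist_ge0. Qed.

Lemma prod_mdist_positivity (R : realFieldType) (X Y : metricType R)
  (z w : X * Y) : prod_mdist z w = 0 -> z = w.
Proof.
case: z w => [x y] [u v] zw0; congr pair; apply: mdist_positivity;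
  by apply/eqP; rewrite eq_le mdist_ge0 andbT -zw0 /prod_mdist le_max lexx ?orbT.
Qed.

(** The product already has a pseudometric; matching its balls with those of the maximum distance
    makes it a metric space with the same topology. *)
Lemma ball_prod_mdist (R : realFieldType) (X Y : metricType R)
  (z : X * Y) (r : R) : ball z r = [set w | prod_mdist z w < r].
Proof.
rewrite /ball /= /prod_ball !ballEmdist.
by apply/seteqP; split => w /=; rewrite gt_max => /andP.
Qed.

HB.instance Definition _ (R : realFieldType) (X Y : metricType R) :=
  PseudoMetric_isMetric.Build R (X * Y)%type
    (@prod_mdist_ge0 R X Y) (@prod_mdist_positivity R X Y)
    (@ball_prod_mdist R X Y).

HB.instance Definition _ (X Y : completeType) := Pointed.on (X * Y)%type.

(** Entourages of a factor pull back to entourages of the product, so both projections of a Cauchy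
    filter are Cauchy; the pair of their limits is a limit. *)
Lemma prod_cauchy_cvg (X Y : completeType) (F : set_system (X * Y)) :
  ProperFilter F -> cauchy F -> [cvg F in (X * Y)%type].
Proof.
move=> FF Fc.
have cvg1 : cvg (fst @ F).
  apply: cauchy_cvg => A entA.
  have /Fc : entourage [set p : (X * Y) * (X * Y) | A (p.1.1, p.2.1)].
    exists (A, setT); first by split => //; exact: filterT.
    by move=> [[a b] [c d]] [/= Aab _]; exists ((a, c), (b, d)).
  move=> [[P Q] [/= FP FQ] PQ].
  exists (fst @` P, fst @` Q).
    by split; [apply: filterS FP | apply: filterS FQ] => z ?; exists z.
  by move=> [_ _] [/= [z Pz <-] [w Qw <-]]; exact: (PQ (z, w)).
have cvg2 : cvg (snd @ F).
  apply: cauchy_cvg => A entA.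
  have /Fc : entourage [set p : (X * Y) * (X * Y) | A (p.1.2, p.2.2)].
    exists (setT, A); first by split => //; exact: filterT.
    by move=> [[a b] [c d]] [/= _ Acd]; exists ((a, c), (b, d)).
  move=> [[P Q] [/= FP FQ] PQ].
  exists (snd @` P, snd @` Q).
    by split; [apply: filterS FP | apply: filterS FQ] => z ?; exists z.
  by move=> [_ _] [/= [z Pz <-] [w Qw <-]]; exact: (PQ (z, w)).
apply/cvg_ex; exists (lim (fst @ F), lim (snd @ F)).
move=> A [[P Q] [/= /cvg1 FP /cvg2 FQ] PQA].
by apply: (@filterS _ F _ _ _ _ (@filterI _ F _ _ _ FP FQ)) => z;
  exact: PQA.
Qed.

HB.instance Definition _ (X Y : completeType) :=
  Uniform_isComplete.Build (X * Y)%type (@prod_cauchy_cvg X Y).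

HB.instance Definition _ (R : realFieldType) (X Y : completeMetricType R) :=
  Complete.on (X * Y)%type.

(* Were the nonincreasing distances to have a positive infimum [i], one of them
   would be close enough to [i] for the next to be at most [i], and the one
   after that would be below [i]. *)
Lemma mdist_iter_lt {R : realType} {Y : metricType R} {F : Y -> Y}
    (F_lt : forall z w, z != w -> mdist (F z) (F w) < mdist z w)
    (F_le : forall e, 0 < e -> exists2 d, 0 < d &
       forall z w, mdist z w < e + d -> mdist (F z) (F w) <= e)
    (z w : Y) {e : R} : 0 < e ->
  exists n, mdist (iter n F z) (iter n F w) < e.
Proof.
move=> e0; apply: contrapT => /forallNP nlt.
pose a n := mdist (iter n F z) (iter n F w).
have a_ge n : e <= a n by rewrite leNgt; exact/negP/nlt.
have has_inf_a : has_inf (range a).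
  by split; [exists (a 0%N), 0%N | exists e => _ [n _ <-]].
have inf_gt0 : 0 < inf (range a).
  apply: (lt_le_trans e0); apply: lb_le_inf; first exact: has_inf_a.1.
  by move=> _ [n _ <-].
have [d d0 Fd] := F_le _ inf_gt0.
have [_ [n _ <-] an_lt] := inf_adherent d0 has_inf_a.
have neq : iter n.+1 F z != iter n.+1 F w.
  by rewrite -mdist_gt0; exact: lt_le_trans (a_ge n.+1).
have := lt_le_trans (F_lt _ _ neq) (Fd _ _ an_lt).
by rewrite ltNge => /negP; apply; apply: ge_inf; [exact: has_inf_a.2|exists n.+2].
Qed.

(* The fixed point theorem of Ciric, Jachymski and Matkowski. *)
Lemma cvg_iter_fixpoint {R : realType} {Y : completeMetricType R} {F : Y -> Y}
    (F_lt : forall z w, z != w -> mdist (F z) (F w) < mdist z w)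
    (F_le : forall e, 0 < e -> exists2 d, 0 < d &
       forall z w, mdist z w < e + d -> mdist (F z) (F w) <= e) :
  exists2 xi, F xi = xi & forall z, iter n F z @[n --> \oo] --> xi.
Proof.
have F_le1 z w : mdist (F z) (F w) <= mdist z w.
  by have [->|/F_lt/ltW//] := eqVneq z w; rewrite !mdistxx.
(* The orbit of a fixed point is constant, so comparing any orbit with it gives convergence; only
   existence is then left. *)
have cvg_fix xi z : F xi = xi -> iter n F z @[n --> \oo] --> xi.
  move=> Fxi; apply/metricType_numDomainType.cvgrPdist_lt => e e0.
  have [n] := mdist_iter_lt F_lt F_le xi z e0.
  have iter_xi k : iter k F xi = xi by elim: k => //= k ->.
  move=> nlt; exists n => // m /= /subnKC <-.
  elim: (m - n)%N => [|k IHk]; first by rewrite addn0 -{1}(iter_xi n).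
  by rewrite addnS iterS -{1}Fxi (le_lt_trans (F_le1 _ _)).
suff [xi Fxi] : exists xi, F xi = xi by exists xi => // z; exact: cvg_fix.
pose u n := iter n F (point : Y).
have /cauchy_cvg/cvg_ex[xi uxi] : cauchy (u @ \oo).
  apply: cauchy_exP => e e0.
  have [d d0 Fd] := F_le _ (divr_gt0 e0 (ltr0n R 2)).
  have [n un_lt] := mdist_iter_lt F_lt F_le point (F point) d0.
  rewrite -iterSr -/(u n) -/(u n.+1) in un_lt.
  have close k : mdist (u n) (u (n + k)%N) < e / 2 + d.
    elim: k => [|k IHk]; first by rewrite addn0 mdistxx addr_gt0 ?divr_gt0.
    rewrite (le_lt_trans (metric_triangle _ (u n.+1) _))// addrC ler_ltD//.
    by rewrite addnS; exact: Fd.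
  (* Centring at [u n.+1] lets one more application of [F] remove [d], whose size is not controlled;
     [e / 2] then makes the bound strict. *)
  exists (u n.+1), n.+1 => // m /= /subnKC <-.
  rewrite ballEmdist /= (le_lt_trans (Fd _ _ (close _)))//.
  by rewrite ltr_pdivrMr// ltr_pMr// ltr1n.
suff uFxi : u n.+1 @[n --> \oo] --> F xi.
  exists xi; apply: (cvg_unique (@metric_hausdorff _ Y) _ uxi).
  by move: uFxi; rewrite cvg_shiftS.
apply/metricType_numDomainType.cvgrPdist_lt => e e0.
have [N _ uN] := metricType_numDomainType.cvgr_dist_lt uxi e0.
by exists N => // n /uN; exact/le_lt_trans/F_le1.
Qed.

(** The upper limit is an infimum of suprema, so near [a] on the right [f] stays below the right
    limit of [g], which is at most [g s] for every [s > a]. *)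
Lemma limf_esup_at_right_lt {R : realType} {f g : R -> R} {a : R}
    (g_nd : forall s t, a <= s -> s <= t -> g s <= g t) :
  (limf_esup (fun t => (f t)%:E) a^'+ < (lim (g t @[t --> a^'+]))%:E)%E ->
  exists2 d, 0 < d &
    forall s t, a < s -> a < t < a + d -> f t < g s.
Proof.
rewrite limf_esupE => /ereal_inf_lt[_ [V aV <-] supV].
(* This makes [lim] a genuine limit rather than a default value; [g a] is the lower bound. *)
have cvg_g : cvg (g t @[t --> a^'+]).
  apply: nondecreasing_at_right_is_cvgr; near=> x.
    by move=> s t; rewrite !in_itv/= => /andP[/ltW sa _] _; exact: g_nd.
  exists (g a) => _ [s /= + <-]; rewrite in_itv/= => /andP[/ltW as_ _].
  exact: g_nd.
have [d /= d0 dV] := aV; exists d => // s t as_ /andP[at_ tad].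
have ft_lt : ((f t)%:E < (lim (g t @[t --> a^'+]))%:E)%E.
  apply: le_lt_trans supV; apply: ereal_sup_ubound; exists t => //.
  by apply: dV => //=; rewrite ltr0_norm ?subr_lt0// opprB ltrBlDl.
rewrite -lte_fin (lt_le_trans ft_lt)// lee_fin; apply: limr_le => //.
near=> x; apply: g_nd; first by apply: ltW; near: x; exact: nbhs_right_gt.
by near: x; exact: nbhs_right_le.
Unshelve. all: by end_near. Qed.

Definition coupled_map {X : Type} (T : X * X -> X) (z : X * X) : X * X :=
  (T (z.1, z.2), T (z.2, z.1)).

Lemma iter_coupled_map (X : Type) (T : X * X -> X) (n : nat) (x y : X) :
  iter n (coupled_map T) (x, y) = (coupled_iter T n x y, coupled_iter T n y x).
Proof. by elim: n => //= n ->. Qed.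

Theorem theorem2p1 (R : realType) (X : completeMetricType R)
    (psi phi : R -> R) (T : X * X -> X)
    (contr : forall x y u v : X,
      0 < Num.max (mdist (T (x, y)) (T (u, v))) (mdist (T (y, x)) (T (v, u))) ->
      (* psi is only given on (0, +oo) *)
      0 < mdist (T (x, y)) (T (u, v)) ->
      psi (mdist (T (x, y)) (T (u, v))) <= phi (Num.max (mdist x u) (mdist y v)))
    (psi_nondecreasing : forall s t : R, 0 < s -> s <= t -> psi s <= psi t)
    (phi_lt_psi : forall t : R, 0 < t -> phi t < psi t)
    (limsup_phi : forall eps : R, 0 < eps ->
      (limf_esup (fun t => (phi t)%:E) eps^'+
         < (lim (psi t @[t --> eps^'+]))%:E)%E) :
  exists xi : X * X,
    unique (fun p : X * X => p.1 = T (p.1, p.2) /\ p.2 = T (p.2, p.1)) xi /\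
    forall x y : X,
      coupled_iter T n x y @[n --> \oo] --> xi.1 /\
      coupled_iter T n y x @[n --> \oo] --> xi.2.
Proof.
pose F := coupled_map T.
have contrF z w : 0 < mdist (F z) (F w) ->
    psi (mdist (F z) (F w)) <= phi (mdist z w).
  case: z w => [x y] [u v] Fzw; rewrite /mdist/= /prod_mdist/= in Fzw *.
  (* The coordinate attaining the maximum has positive distance, as [contr] requires. *)
  move: Fzw; case: (leP (mdist (T (x, y)) _)) => _ Fzw.
    by rewrite [in leRHS]maxC; apply: contr => //; rewrite lt_max Fzw.
  by apply: contr => //; rewrite lt_max Fzw.
have F_lt z w : z != w -> mdist (F z) (F w) < mdist z w.
  rewrite -mdist_gt0 => zw0; rewrite ltNge; apply/negP => le_zw.
  have := contrF z w (lt_le_trans zw0 le_zw); apply/negP; rewrite -ltNge.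
  exact: lt_le_trans (phi_lt_psi _ zw0) (psi_nondecreasing _ _ zw0 le_zw).
have F_le e : 0 < e -> exists2 d, 0 < d &
    forall z w, mdist z w < e + d -> mdist (F z) (F w) <= e.
  move=> e0; have psi_nd s t : e <= s -> s <= t -> psi s <= psi t.
    by move=> es; apply: psi_nondecreasing; exact: lt_le_trans es.
  have [d d0 phi_lt] := limf_esup_at_right_lt psi_nd (limsup_phi e e0).
  (* The upper limit controls only distances above [e]; up to [e], it suffices that [F] is
     nonexpansive. *)
  exists d => // z w zw_lt; have [zw_le|zw_gt] := leP (mdist z w) e.
    have [->|/F_lt/ltW/le_trans->//] := eqVneq z w.
    by rewrite mdistxx ltW.
  rewrite leNgt; apply/negP => Fzw.
  have := contrF z w (lt_trans e0 Fzw); apply/negP; rewrite -ltNge.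
  by apply: phi_lt => //; rewrite zw_gt.
have [xi Fxi cvg_xi] := cvg_iter_fixpoint F_lt F_le.
exists xi; split; first split.
- by rewrite -{1 4}Fxi.
- move=> w [w1 w2]; have Fw : F w = w.
    by rewrite /F /coupled_map -w1 -w2 -surjective_pairing.
  apply/eqP; apply: contraT => /F_lt.
  by rewrite Fxi Fw ltxx.
- move=> x y; have cvg_xy := cvg_xi (x, y).
  split.
    rewrite (_ : (fun _ => _) = fun n => (iter n F (x, y)).1); last first.
      by apply/funext => n; rewrite iter_coupled_map.
    by apply: (cvg_comp (fun n => iter n F (x, y)) fst cvg_xy); exact: cvg_fst.
  rewrite (_ : (fun _ => _) = fun n => (iter n F (x, y)).2); last first.
    by apply/funext => n; rewrite iter_coupled_map.
  by apply: (cvg_comp (fun n => iter n F (x, y)) snd cvg_xy); exact: cvg_snd.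
Qed.
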